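(* Let $\mathcal{A}$ be an infinite Boolean algebra. If $\mathcal{A}$ carries an anti-Nikodym sequence of measures which has a strong Nikodym concentration point in $St(\mathcal{A})$, then there are an anti-Nikodym sequence $(\nu_k)_{k\in\omega}$ of measures on $\mathcal{A}$ and an antichain $(B_k)_{k\in\omega}$ in $\mathcal{A}$ such that for every $k\in\omega$: $\operatorname{supp}(\widehat{\nu}_k)\subseteq[B_k]$ and $\|\nu_k\|>k$.
   Context: A measure on a Boolean algebra $\mathcal{A}$ is a finitely additive $\mu\colon\mathcal{A}\to\mathbb{R}$ with finite variation norm $\|\mu\|=\sup\{|\mu(A)|+|\mu(B)|\colon A\wedge B=0\}$; $\mu\restriction A$ denotes $B\mapsto\mu(A\wedge B)$. $St(\mathcal{A})$ is the Stone space, $[A]$ the clopen set of ultrafilters containing $A$, and $\widehat\mu$ the Radon extension of $\mu$ to $St(\mathcal{A})$; $\operatorname{supp}$ is the support (smallest closed set of full variation). An antichain is a sequence of pairwise disjoint ($A_i\wedge A_j=0$) elements. A sequence $(\mu_n)$ is anti-Nikodym if $\lim_n\mu_n(A)=0$ for all $A\in\mathcal{A}$ and $\sup_n\|\mu_n\|=\infty$. $t\in St(\mathcal{A})$ is a strong Nikodym concentration point of $(\mu_n)$ if for every $N\in\omega$ and $A\in\mathcal{A}$ with $t\in[A]$ there are a clopen $U\subseteq[A]\setminus\{t\}$ and $n$ with $|\widehat\mu_n(U)|>N(\|\mu_n\restriction A^c\|+1)$. *)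

(* Defs.v *)
From HB Require Import structures.
From mathcomp Require Import all_boot all_order all_algebra.
From mathcomp Require Import all_classical all_reals all_analysis.

Set Implicit Arguments.
Unset Strict Implicit.
Unset Printing Implicit Defensive.

Import Order.TTheory GRing.Theory Num.Theory.
Import numFieldNormedType.Exports.

Local Open Scope classical_set_scope.
Local Open Scope ring_scope.

(** Boolean algebras are the complemented distributive lattices with top and
    bottom; their operations are written in [order_scope]. *)

Section Measures.
Context {d : Order.disp_t} {A : ctbDistrLatticeType d} {R : realType}.
Implicit Types (a b : A) (mu : A -> R).

Definition variation_norm mu : \bar R :=
  ereal_sup [set x | exists a b,
    (a `&` b = \bot)%O /\ x = (`|mu a| + `|mu b|)%:E].

Definition is_measure mu : Prop :=
  (forall a b, (a `&` b = \bot)%O -> mu (a `|` b)%O = mu a + mu b) /\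
  (variation_norm mu < +oo)%E.

Definition mrestrict mu a : A -> R := fun b => mu (a `&` b)%O.

Definition antichain (B : nat -> A) : Prop :=
  forall i j, i <> j -> (B i `&` B j = \bot)%O.

Definition anti_nikodym (mu : nat -> A -> R) : Prop :=
  [/\ forall n, is_measure (mu n),
      forall a, mu n a @[n --> \oo] --> (0 : R)
    & ereal_sup (range (fun n => variation_norm (mu n))) = +oo%E].

End Measures.

Section StoneSpace.
Context {d : Order.disp_t} (A : ctbDistrLatticeType d).

Definition is_ultrafilter (F : set A) : Prop :=
  [/\ F \top%O /\ ~ F \bot%O,
      forall a b, F a -> F b -> F (a `&` b)%O,
      forall a b, (a <= b)%O -> F a -> F b
    & forall a, F a \/ F (~` a)%O].

Definition stone : Type := {F : set A | is_ultrafilter F}.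

HB.instance Definition _ := gen_eqMixin stone.
HB.instance Definition _ := gen_choiceMixin stone.

(** The set [[a]] of ultrafilters containing [a]. *)
Definition stone_set (a : A) : set stone := [set t | sval t a].

(** The topology having the sets [stone_set a] as a base. *)
Definition stone_open : set (set stone) :=
  [set U | forall t, U t -> exists2 a, stone_set a t & stone_set a `<=` U].

Lemma stone_openT : stone_open setT.
Proof. by move=> t _; exists \top%O => //; case: (svalP t) => -[]. Qed.

Lemma stone_openI : setI_closed stone_open.
Proof.
move=> U V oU oV t [/oU[a ta aU] /oV[b tb bV]]; exists (a `&` b)%O.
  by case: (svalP t) => _ tI _ _; apply: tI.
by move=> s; case: (svalP s) => _ _ le_s _ sab; split;
  [apply: aU|apply: bV]; apply: le_s sab; [apply: leIl|apply: leIr].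
Qed.

Lemma stone_open_bigU (I : Type) (f : I -> set stone) :
  (forall i, stone_open (f i)) -> stone_open (\bigcup_i f i).
Proof.
by move=> of_ t [i _ /of_[a ta af]]; exists a => // s /af; exists i.
Qed.

HB.instance Definition _ :=
  isOpenTopological.Build stone stone_openT stone_openI stone_open_bigU.

End StoneSpace.

(** Real-valued Borel measures on a topological space. The measurable types of
    the library are pointed, while a Stone space may be empty, hence the direct
    definition over the Borel sigma-algebra. *)
Section SignedBorel.
Context {T : topologicalType} {R : realType}.
Implicit Types (m : set T -> R) (E F : set T).

Definition borel : set (set T) := <<s (@open T) >>.

Definition is_signed_borel m : Prop :=
  forall F : nat -> set T, (forall i, borel (F i)) -> trivIset setT F ->
    (\sum_(0 <= i < n) m (F i)) @[n --> \oo] --> m (\bigcup_i F i).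

Definition total_variation m E : \bar R :=
  ereal_sup [set x | exists B C, [/\ borel B, borel C, B `<=` E, C `<=` E &
    B `&` C = set0 /\ x = (`|m B| + `|m C|)%:E]].

(** Finiteness of the variation is automatic for real-valued [m]. *)
Definition is_radon m : Prop :=
  is_signed_borel m /\
  forall E (e : R), borel E -> 0 < e ->
    exists K, [/\ compact K, borel K, K `<=` E &
      (total_variation m (E `\` K) < e%:E)%E].

Definition radon_support m : set T :=
  \bigcap_(F in [set F | closed F /\
                   total_variation m F = total_variation m setT]) F.

End SignedBorel.

Section RadonExtension.
Context {d : Order.disp_t} {A : ctbDistrLatticeType d} {R : realType}.

Definition is_radon_extension (mu : A -> R) (m : set (stone A) -> R) : Prop :=
  is_radon m /\ forall a, m (stone_set a) = mu a.

(** For a measure [mu] an extension exists, and any two of them agree on Borel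
    sets, the only sets on which the values of [radon_extension mu] are used. *)
Definition radon_extension (mu : A -> R) : set (stone A) -> R :=
  xget (fun=> 0) (is_radon_extension mu).

Definition strong_nikodym_point (mu : nat -> A -> R) (t : stone A) : Prop :=
  forall (N : nat) (a : A), stone_set a t ->
    exists (U : set (stone A)) (n : nat),
      [/\ clopen U, U `<=` stone_set a `\` [set t] &
        (N%:R%:E * (variation_norm (mrestrict (mu n) (~` a)%O) + 1)
          < `|radon_extension (mu n) U|%:E)%E].

End RadonExtension.

(* Main.v *)
(** Let [t] be a strong Nikodym concentration point of [(mu_n)]. Rescaling members
    of the sequence and shrinking around [t], one builds [a_0 >= a_1 >= ...] in
    [t], elements [b_k <= a_k] disjoint from [a_(k+1)], and measures [lam_k],
    converging pointwise to [0], such that [|lam_k b_k|] is large while [lam_k] is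
    small below [~ a_k] and, away from [t], below [a_(k+1)]. What [lam_k] does on
    [a_(k+1)] is therefore essentially an atom at [t]. A combination of
    [lam_(2k)] and [lam_(2k+1)] vanishing on [a_(2k+2)], with coefficients of
    maximal modulus [1], cancels these atoms; restricting it to
    [B_k = a_(2k) \ a_(2k+2)] changes it by a quantity tending to [0] pointwise,
    and keeps it large on [b_(2k)] or [b_(2k+1)].

    Existence of Radon extensions is not needed: when a measure has none,
    [radon_extension] is the zero function. *)

Require Import Defs.
From mathcomp Require Import all_boot all_order all_algebra.
From mathcomp Require Import all_classical all_reals all_analysis.
From mathcomp Require Import lra.

Import Order.Theory GRing.Theory Num.Theory.
Import numFieldNormedType.Exports.
Local Open Scope classical_set_scope.
Local Open Scope ring_scope.

(** * Ultrafilters and the topology of the Stone space *)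

Section Ultrafilters.
Context {d : Order.disp_t} {A : ctbDistrLatticeType d}.
Implicit Types (a b : A) (t : stone A) (K V : set (stone A)).

Lemma stoneS t a b : (a <= b)%O -> sval t a -> sval t b.
Proof. by case: (svalP t) => _ _ + _; apply. Qed.

Lemma stoneI t a b : sval t (a `&` b)%O <-> sval t a /\ sval t b.
Proof.
split=> [tab|[ta tb]]; first by split; apply: stoneS tab; rewrite ?leIl ?leIr.
by case: (svalP t) => _ tI _ _; apply: tI.
Qed.

Lemma stoneC t a : sval t (~` a)%O <-> ~ sval t a.
Proof.
case: (svalP t) => -[_ t0] tI _ tC; split=> [tNa ta|nta].
  by apply: t0; rewrite -(meetxC a); apply: tI.
by have [] := tC a.
Qed.

Lemma stone_disj t a b : (a `&` b = \bot)%O -> sval t a -> ~ sval t b.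
Proof.
case: (svalP t) => -[_ t0] tI _ _ ab0 ta tb; apply: t0; rewrite -ab0.
exact: tI.
Qed.

Lemma stoneU t a b : sval t (a `|` b)%O -> sval t a \/ sval t b.
Proof.
move=> tab; apply: contrapT => /not_orP[/stoneC ta /stoneC tb].
by have := (stoneI t _ _).2 (conj ta tb); rewrite -complU => /stoneC.
Qed.

Lemma stone_setI a b : stone_set (a `&` b)%O = stone_set a `&` stone_set b.
Proof. by apply/seteqP; split=> t /stoneI. Qed.

Lemma stone_setC a : stone_set (~` a)%O = ~` stone_set a.
Proof. by apply/seteqP; split=> t /stoneC. Qed.

Lemma open_stone_set a : open (stone_set a).
Proof. by move=> t ta; exists a. Qed.

Lemma closed_stone_set a : closed (stone_set a).
Proof. by rewrite -openC -stone_setC; apply: open_stone_set. Qed.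

Lemma stone_hausdorff : hausdorff_space (stone A).
Proof.
rewrite open_hausdorff => s t st.
have [a sa ta] : exists2 a, sval s a & ~ sval t a.
  apply: contrapT => /forall2NP st'; move/eqP: st; apply.
  apply: eq_sig_hprop => [x p q|]; first exact: Prop_irrelevance.
  apply/seteqP; split=> a.
    by move=> sa; have [//|/contrapT] := st' a.
  move=> ta; apply: contrapT => /stoneC sa.
  by have [//|/contrapT/stoneC] := st' (~` a)%O.
exists (stone_set a, stone_set (~` a)%O).
  by rewrite !inE; split=> //=; apply/stoneC.
split; [exact: open_stone_set|exact: open_stone_set|].
by rewrite stone_setC /= setICr.
Qed.

(** An ultrafilter [F] of sets of points converges to the point [G] made of those [a] whose clopen
    set [stone_set a] belongs to [F]. *)
Lemma stone_compact : compact [set: stone A].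
Proof.
rewrite compact_ultra => F FU _.
pose G : set A := [set a | F (stone_set a)].
have GU : is_ultrafilter G.
  split.
  - split; rewrite /G /=.
      by apply: filterS filterT => t _; case: (svalP t) => -[].
    move=> F0; apply: (@filter_not_empty _ F); apply: filterS F0 => t.
    by case: (svalP t) => -[].
  - by move=> a b Fa Fb; rewrite /G /= stone_setI; apply: filterI.
  - by move=> a b ab; apply: filterS => t; apply: stoneS.
  - by move=> a; rewrite /G /= stone_setC; apply: in_ultra_setVsetC.
exists (exist _ G GU); split=> // V; rewrite nbhsE => -[W [oW Wt] WV].
have [a Ga aW] := oW _ Wt.
by apply: filterS Ga => t /aW /WV.
Qed.

(** The basic sets inside [V] are closed under finite unions. If none of them covered [K], their
    remainders in [K] would generate a proper filter. It would cluster at some [p] in [K], but a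
    basic neighbourhood of [p] inside [V] has its own remainder in the filter. *)
Lemma compact_stone_set_between K V : compact K -> open V -> K `<=` V ->
  exists2 b, K `<=` stone_set b & stone_set b `<=` V.
Proof.
move=> cK oV KV; apply: contrapT => /forall2NP nKV.
pose F : set_system (stone A) := [set S | exists2 b,
  stone_set b `<=` V & K `\` stone_set b `<=` S].
have FF : ProperFilter F.
  apply: Build_ProperFilter_ex => [S [b bV bS]|].
    have [/existsNP[t /not_implyP[Kt bt]]|//] := nKV b.
    by exists t; apply: bS.
  split.
  - exists \bot%O => // t tb; case: (svalP t) => -[_ /(_ tb)] //.
  - move=> P Q [a aV aP] [b bV bQ]; exists (a `|` b)%O.
      by move=> t /stoneU[/aV|/bV].
    move=> t [Kt tab]; split; [apply: aP|apply: bQ]; split=> // tx; apply: tab.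
      by apply: stoneS tx; rewrite leUl.
    by apply: stoneS tx; rewrite leUr.
  - by move=> P Q PQ [b bV bP]; exists b => // t /bP /PQ.
have FK : F K.
  exists \bot%O; last by move=> t [].
  by move=> t tb; case: (svalP t) => -[_ /(_ tb)].
have [p [Kp clp]] := cK F FF FK.
have [a pa aV] := oV _ (KV _ Kp).
have Fa : F (K `\` stone_set a) by exists a.
have na : nbhs p (stone_set a).
  by apply: open_nbhs_nbhs; split=> //; apply: open_stone_set.
by have [q [[_ nq] qa]] := clp _ _ Fa na.
Qed.

Lemma clopen_stone_set V : clopen V -> exists b, V = stone_set b.
Proof.
move=> [oV cV]; have cpV := subclosed_compact cV stone_compact (@subsetT _ V).
have [b Vb bV] := compact_stone_set_between V V cpV oV (@subset_refl _ V).
by exists b; apply/seteqP.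
Qed.

End Ultrafilters.

(** * Signed Borel measures: additivity, variation, support *)

Section BorelMeasures.
Context {T : topologicalType} {R : realType}.
Implicit Types (m : set T -> R) (E F : set T).

Lemma borel_open E : open E -> borel E.
Proof. exact: sub_gen_smallest. Qed.

Lemma borel0 : borel (set0 : set T).
Proof. exact: sigma_algebra0. Qed.

Lemma borelC E : borel E -> borel (~` E).
Proof. by rewrite -setTD; apply: sigma_algebraCD. Qed.

Lemma borel_closed E : closed E -> borel E.
Proof.
by rewrite -(setCK E) => /closed_openC/borel_open/borelC; rewrite !setCK.
Qed.

Lemma borelU E F : borel E -> borel F -> borel (E `|` F).
Proof.
move=> bE bF; rewrite -bigcup2E; apply: sigma_algebra_bigcup => -[|[|i]] //=.
exact: borel0.
Qed.

Lemma borelI E F : borel E -> borel F -> borel (E `&` F).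
Proof.
move=> bE bF; rewrite -(setCK (E `&` F)) setCI.
by apply: borelC; apply: borelU; exact: borelC.
Qed.

Lemma borelD E F : borel E -> borel F -> borel (E `\` F).
Proof. by rewrite setDE => bE /borelC; apply: borelI. Qed.

(** The series with all terms [m set0] converges, so its terms tend to [0]. *)
Lemma signed_borel0 m : is_signed_borel m -> m set0 = 0.
Proof.
move=> /(_ (fun=> set0)); rewrite bigcup0// => /(_ (fun=> borel0)).
have tr : trivIset setT (fun _ : nat => set0 : set T).
  by apply/trivIsetP => i j _ _ _; rewrite setI0.
move=> /(_ tr) h; have := cvg_series_cvg_0 (cvgP _ h).
by move=> /cvg_lim; rewrite lim_cst// => ->.
Qed.

Lemma signed_borelU m E F : is_signed_borel m -> borel E -> borel F ->
  E `&` F = set0 -> m (E `|` F) = m E + m F.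
Proof.
move=> mm bE bF EF0; have m0 := signed_borel0 _ mm.
have := mm (bigcup2 E F); rewrite bigcup2E => h.
have /h {}h : forall i, borel (bigcup2 E F i).
  by move=> -[|[|i]] //=; exact: borel0.
have /h {}h : trivIset setT (bigcup2 E F) by rewrite -trivIset_bigcup2.
rewrite -(cvg_lim (@Rhausdorff R) h); apply: (cvg_lim (@Rhausdorff R)).
(* [bigcup2] pads with the empty set, so the partial sums are constant from index 2 on. *)
rewrite -(cvg_shiftn 2); apply: cvg_near_cst; near=> n.
rewrite /= addn2 big_nat_recl// big_nat_recl//= big1 ?addr0// => i _; exact: m0.
Unshelve. all: by end_near. Qed.

Lemma signed_borelDI m E F : is_signed_borel m -> borel E -> borel F ->
  m E = m (E `\` F) + m (E `&` F).
Proof.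
move=> mm bE bF; rewrite -{1}(setUIDK E F) setUC signed_borelU//.
- exact: borelD.
- exact: borelI.
- by apply/seteqP; split=> // x [[_ nFx] []].
Qed.

Lemma norm_lt_total_variation m E F (e : R) : is_signed_borel m ->
  (Defs.total_variation m F < e%:E)%E -> borel E -> E `<=` F -> `|m E| < e.
Proof.
move=> mm tv bE EF; rewrite -lte_fin; apply: le_lt_trans tv.
apply: ereal_sup_ubound; exists E, set0; split=> //; first exact: borel0.
by rewrite setI0 signed_borel0// normr0 addr0.
Qed.

(** Cutting Borel sets down to [F] does not change their values under [m], so [F] carries the whole
    variation and is one of the closed sets being intersected. *)
Lemma radon_support_sub m F : closed F ->
  is_signed_borel m -> (forall E, borel E -> E `<=` ~` F -> m E = 0) ->
  radon_support m `<=` F.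
Proof.
move=> cF mm mF; apply: bigcap_inf; split=> //; apply/eqP; rewrite eq_le.
have bF := borel_closed _ cF.
apply/andP; split; apply: ge_ereal_sup => x [B [C [bB bC BF CF [BC0 ->]]]].
  by apply: ereal_sup_ubound; exists B, C.
apply: ereal_sup_ubound; exists (B `&` F), (C `&` F); split.
- exact: borelI.
- exact: borelI.
- exact: subIsetr.
- exact: subIsetr.
- split; first by rewrite setIACA BC0 set0I.
  rewrite (signed_borelDI m B F)// (signed_borelDI m C F)//.
  rewrite !(mF (_ `\` F)) ?add0r//; exact: borelD.
Qed.

End BorelMeasures.

(** * Radon extensions: vanishing and support *)

Lemma radon_vanish {d : Order.disp_t} {A : ctbDistrLatticeType d}
    {R : realType} (m : set (stone A) -> R) (a : A) :
  is_radon m -> (forall b, (b <= a)%O -> m (stone_set b) = 0) ->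
  forall E, borel E -> E `<=` stone_set a -> m E = 0.
Proof.
move=> [mm mr] ma E bE Ea.
apply/eqP; rewrite -normr_eq0; apply/eqP/le_anti; rewrite normr_ge0 andbT.
apply/ler_addgt0Pl => e e0; rewrite addr0.
have e20 : 0 < e / 2 by rewrite divr_gt0.
have ba : borel (stone_set a) by apply: borel_open; exact: open_stone_set.
(* Inner regularity is used on both sides of [E]. A clopen set containing [K] and avoiding [L]
   differs from [E] by two sets of measure below [e / 2], and [m] vanishes on it. *)
have [K [cK bK KE Ke]] := mr E _ bE e20.
have [L [cL bL LE Le]] := mr (stone_set a `\` E) _ (borelD _ _ ba bE) e20.
have [b Kb bV] :
    exists2 b, K `<=` stone_set b & stone_set b `<=` stone_set a `\` L.
  apply: compact_stone_set_between => //.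
    rewrite setDE; apply: openI; first exact: open_stone_set.
    by apply: closed_openC; apply: compact_closed cL; exact: stone_hausdorff.
  by move=> t Kt; split=> [|/LE[_]]; [apply/Ea/KE|apply; apply: KE].
have bb : borel (stone_set b) by apply: borel_open; exact: open_stone_set.
have mb : m (stone_set b) = 0.
  have -> : stone_set b = stone_set (b `&` a)%O.
    by rewrite stone_setI; apply/esym/setIidl => t /bV[].
  by apply: ma; rewrite leIr.
have h1 := signed_borelDI m _ _ mm bE bb.
have h2 := signed_borelDI m _ _ mm bb bE.
have : `|m (E `\` stone_set b)| < e / 2.
  apply: (norm_lt_total_variation _ _ _ _ mm Ke); first exact: borelD.
  by move=> t [Et bt]; split=> // /Kb.
have : `|m (stone_set b `\` E)| < e / 2.
  apply: (norm_lt_total_variation _ _ _ _ mm Le); first exact: borelD.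
  by move=> t [bt Et]; have [ta Lt] := bV _ bt; split.
rewrite setIC in h2; move: h1 h2; rewrite mb => -> /esym/eqP.
rewrite addrC addr_eq0 => /eqP ->; rewrite !ltr_norml => /andP[? ?] /andP[? ?].
by rewrite ler_norml; apply/andP; split; lra.
Qed.

Lemma radon_extension_spec {d : Order.disp_t} {A : ctbDistrLatticeType d}
    {R : realType} (mu : A -> R) :
  is_radon_extension mu (radon_extension mu) \/ radon_extension mu = (fun=> 0).
Proof.
have [ex|nex] := pselect (exists m, is_radon_extension mu m).
  by left; apply: xgetPex.
by right; apply: xgetPN => m hm; apply: nex; exists m.
Qed.

(** By [radon_vanish], vanishing below the complement of [a] spreads to all Borel sets outside
    [stone_set a]. *)
Lemma radon_support_extension_sub {d : Order.disp_t} {A : ctbDistrLatticeType d}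
    {R : realType} (mu : A -> R) (a : A) :
  (forall b, (b <= ~` a)%O -> mu b = 0) ->
  radon_support (radon_extension mu) `<=` stone_set a.
Proof.
move=> mua; have [[mr mE]|->] := radon_extension_spec mu.
  apply: radon_support_sub; first exact: closed_stone_set.
    by case: mr.
  rewrite -stone_setC => E; apply: radon_vanish => // b ba.
  by rewrite mE mua.
apply: radon_support_sub => //; first exact: closed_stone_set.
move=> F _ _ /=; under eq_fun do rewrite big1//; exact: cvg_cst.
Qed.

(** * Finitely additive measures on the algebra *)

Section Measures.
Context {d : Order.disp_t} {A : ctbDistrLatticeType d} {R : realType}.
Implicit Types (a b x : A) (mu : A -> R) (t : stone A).

Lemma variation_norm_ge mu x : (`|mu x|%:E <= variation_norm mu)%E.
Proof.
apply: (@le_trans _ _ (`|mu x| + `|mu \bot%O|)%:E).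
  by rewrite lee_fin lerDl.
by apply: ereal_sup_ubound; exists x, \bot%O; rewrite meetx0.
Qed.

(** Each sum in the variation norm is at most twice a uniform bound; real bounds spare computations
    in [\bar R]. *)
Lemma is_measureP mu : is_measure mu <->
  (forall a b, (a `&` b = \bot)%O -> mu (a `|` b)%O = mu a + mu b) /\
  exists C, forall x, `|mu x| <= C.
Proof.
split=> -[muU].
  move=> mufin; split=> //; exists (fine (variation_norm mu)) => x.
  have := variation_norm_ge mu x; move: mufin.
  by case: (variation_norm mu) => [r _|//|_]; rewrite ?lee_fin ?leeNy_eq.
move=> [C muC]; split=> //.
apply: (@le_lt_trans _ _ (C + C)%:E); last exact: ltry.
by apply: ge_ereal_sup => _ [a [b [_ ->]]]; rewrite lee_fin lerD.
Qed.

Lemma measure_split mu a x : is_measure mu ->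
  mu x = mu (x `&` a)%O + mu (x `&` ~` a)%O.
Proof.
move=> [muU _]; rewrite -muU; first by rewrite -meetUr joinxC meetx1.
by rewrite meetACA meetxC meetx0.
Qed.

Lemma is_measure_comb mu mu' (r s : R) : is_measure mu -> is_measure mu' ->
  is_measure (fun x => r * mu x + s * mu' x).
Proof.
move=> /is_measureP[muU [C muC]] /is_measureP[mu'U [C' mu'C]].
apply/is_measureP; split=> [a b ab|]; first by rewrite muU// mu'U//; lra.
exists (`|r| * C + `|s| * C') => x; apply: (le_trans (ler_normD _ _)).
by rewrite !normrM lerD// ler_wpM2l.
Qed.

Lemma is_measure_scale mu (r : R) : is_measure mu ->
  is_measure (fun x => r * mu x).
Proof.
move=> m; have := is_measure_comb mu mu r 0 m m.
by congr is_measure; apply/funext => x; rewrite mul0r addr0.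
Qed.

Lemma is_measure_restrict mu a : is_measure mu ->
  is_measure (Defs.mrestrict mu a).
Proof.
move=> /is_measureP[muU [C muC]]; apply/is_measureP; split; last first.
  by exists C => x; apply: muC.
move=> x y xy; rewrite /Defs.mrestrict meetUr muU//.
by rewrite meetACA xy meetx0.
Qed.

(* The supremum of [mu] over the elements outside [t] is nearly attained at some
   [b]; an element disjoint from [b] then has small measure. *)
Lemma measure_le_near_point mu t (e : R) : is_measure mu -> 0 < e ->
  exists2 a, sval t a & forall x, (x <= a)%O -> ~ sval t x -> mu x <= e.
Proof.
move=> /is_measureP[muU [C muC]] e0.
pose S : set R := [set mu x | x in [set x | ~ sval t x]].
have ubS : has_ubound S.
  by exists C => _ [x _ <-]; apply: le_trans (ler_norm _) (muC x).
have supS : has_sup S.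
  split=> //; exists (mu \bot%O), \bot%O => //=; by case: (svalP t) => -[].
have [_ [b ntb <-] bsup] := sup_adherent e0 supS.
exists (~` b)%O; first exact/stoneC.
move=> x xb ntx.
have xb0 : (b `&` x = \bot)%O by apply/eqP; rewrite meetC disj_leC.
have : S (mu (b `|` x)%O) by exists (b `|` x)%O => //= /stoneU[].
move=> /(ub_le_sup ubS); rewrite muU//; lra.
Qed.

(** The one-sided bound is taken for [mu] and for its negative, and the two elements of [t] are met
    with [a]. *)
Lemma measure_small_near_point mu t (e : R) a : is_measure mu -> 0 < e ->
  sval t a -> exists a', [/\ (a' <= a)%O, sval t a' &
    forall x, (x <= a')%O -> ~ sval t x -> `|mu x| <= e].
Proof.
move=> mmu e0 ta.
have [b tb bP] := measure_le_near_point mu t e mmu e0.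
have mN : is_measure (fun x => -1 * mu x) by apply: is_measure_scale.
have [c tc cP] := measure_le_near_point _ t e mN e0.
exists (a `&` (b `&` c))%O; split; first exact: leIl.
  by apply/stoneI; split=> //; apply/stoneI.
move=> x; rewrite !lexI => /and3P[_ xb xc] ntx; rewrite ler_norml.
have := bP x xb ntx; have := cP x xc ntx.
by rewrite mulN1r => ? ?; apply/andP; lra.
Qed.

End Measures.

(** * The shrinking construction around a concentration point *)

Section ConcentrationPoint.
Context {d : Order.disp_t} {A : ctbDistrLatticeType d} {R : realType}.
Context (mu : nat -> A -> R) (t : stone A).
Context (mmu : forall n, is_measure (mu n)) (tmu : strong_nikodym_point mu t).

(** This moves the definition into the algebra: the clopen set becomes an element [b], and [M] is
    the norm of the restriction plus 1. *)
Lemma strong_nikodym_pointP (N : nat) (a : A) : sval t a ->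
  exists b n, [/\ (b <= a)%O, ~ sval t b & exists M : R,
    [/\ 1 <= M, forall x, (x <= ~` a)%O -> `|mu n x| <= M
      & N%:R * M < `|mu n b| ]].
Proof.
move=> /(tmu N)[U [n [cU Ua]]].
have mr := is_measure_restrict _ (~` a)%O (mmu n).
set V := variation_norm _.
have Vge x : (x <= ~` a)%O -> (`|mu n x|%:E <= V)%E.
  move=> xa; have := variation_norm_ge (Defs.mrestrict (mu n) (~` a)%O) x.
  by rewrite /Defs.mrestrict; move/meet_idPr: xa => ->.
have V0 : (0 <= V)%E by apply: le_trans (Vge \bot%O (le0x _)); rewrite lee_fin.
have [b Ub] := clopen_stone_set _ cU.
have {Ub} Ub : U = stone_set (b `&` a)%O.
  by rewrite stone_setI -Ub; apply/esym/setIidl => s /Ua[].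
case: mr => _; rewrite -/V.
case: V V0 Vge => // v v0 vge _.
rewrite -EFinD -EFinM lte_fin => big.
have /= {}big : N%:R * (v + 1) < `|mu n (b `&` a)%O|.
  (* The default value [0] of [radon_extension] cannot exceed the nonnegative left-hand side, so
     here an extension exists. *)
  have [[_ mE]|m0] := radon_extension_spec (mu n).
    by rewrite -mE -Ub.
  by move: big; rewrite m0 normr0 ltNge mulr_ge0// addr_ge0.
exists (b `&` a)%O, n; split; first exact: leIr.
  move=> tb; have [_ /(_ erefl)] // : (stone_set a `\` [set t]) t.
  by apply: Ua; rewrite Ub.
exists (v + 1); split=> // [|x /vge]; first by rewrite lerDr.
by rewrite lee_fin => /le_trans; apply; rewrite lerDl.
Qed.

Lemma concentration_step (k : nat) (a : A) : sval t a ->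
  exists p : (A -> R) * A * A, let: (lam, b, a') := p in
  [/\ is_measure lam,
      exists2 n, (k <= n)%N & forall x, `|lam x| <= `|mu n x|,
      forall x, (x <= ~` a)%O -> `|lam x| <= k.+1%:R^-1,
      (b <= a)%O /\ (k.+2%:R < `|lam b|) &
      [/\ sval t a', (a' <= a)%O, (b `&` a' = \bot)%O &
        forall x, (x <= a')%O -> ~ sval t x -> `|lam x| <= k.+1%:R^-1]].
Proof.
move=> ta.
have [C Cmu] : exists C : R, forall n x, (n < k)%N -> `|mu n x| <= C.
  have /choice[C CP] : forall n, exists C, forall x, `|mu n x| <= C.
    by move=> n; have /is_measureP[_] := mmu n.
  exists (\sum_(i < k) C i) => n x nk; apply: (le_trans (CP n x)).
  rewrite (bigD1 (Ordinal nk))//= lerDl sumr_ge0// => i _.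
  exact: le_trans (normr_ge0 _) (CP i x).
(* The product makes [mu n b] exceed [k.+2] after division by [k.+1%:R * M]. The other summand
   exceeds the bound [C] on the first [k] measures, which forces [k <= n]. *)
pose N := (k.+2 * k.+1 + (Num.truncn C).+1)%N.
have NC : C <= N%:R.
  rewrite natrD; apply: (@le_trans _ _ (Num.truncn C).+1%:R).
    by apply: ltW; apply: truncnS_gt.
  by rewrite lerDr.
have [b [n [ba ntb [M [M1 Ma Mb]]]]] := strong_nikodym_pointP N a ta.
have M0 : 0 < M by lra.
(* Dividing by [M] gives the bound [k.+1%:R^-1] below the complement of [a]; as [r <= 1], [lam]
   stays dominated by [mu n]. *)
pose r := (k.+1%:R * M)^-1; pose lam x := r * mu n x.
have kM1 : 1 <= k.+1%:R * M by rewrite mulr_ege1// ler1n.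
have r0 : 0 < r by rewrite invr_gt0; lra.
have r1 : r <= 1 by rewrite invf_le1//; lra.
have mlam : is_measure lam by apply: is_measure_scale.
have tb : sval t (a `&` ~` b)%O by apply/stoneI; split=> //; apply/stoneC.
have e0 : 0 < k.+1%:R^-1 :> R by rewrite invr_gt0.
have [a' [a'ab ta' a'P]] := measure_small_near_point lam t _ _ mlam e0 tb.
exists (lam, b, a'); split=> //.
- exists n; last by move=> x; rewrite normrM gtr0_norm// ler_piMl.
  rewrite leqNgt; apply/negP => nk.
  have := Cmu n b nk; rewrite leNgt => /negP; apply.
  apply: le_lt_trans Mb; apply: (le_trans NC).
  by rewrite ler_peMr.
- move=> x /Ma xM; rewrite normrM gtr0_norm// /r invfM -mulrA ler_piMr//.
  by rewrite ler_pdivrMl// mulr1.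
- split=> //; rewrite normrM gtr0_norm// /r mulrC ltr_pdivlMr; last by lra.
  apply: le_lt_trans Mb; rewrite mulrA ler_wpM2r//; first by lra.
  by rewrite -natrM ler_nat leq_addr.
- split=> //; first by apply: le_trans a'ab _; exact: leIl.
  apply/eqP; rewrite meetC disj_leC; apply: le_trans a'ab _; exact: leIr.
Qed.

Lemma concentration_sequence : exists (a b : nat -> A) (lam : nat -> A -> R),
  (forall k, sval t (a k)) /\ forall k,
  [/\ is_measure (lam k),
      exists2 n, (k <= n)%N & forall x, `|lam k x| <= `|mu n x|,
      forall x, (x <= ~` a k)%O -> `|lam k x| <= k.+1%:R^-1,
      (b k <= a k)%O /\ (k.+2%:R < `|lam k (b k)|) &
      [/\ (a k.+1 <= a k)%O, (b k `&` a k.+1 = \bot)%O &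
        forall x, (x <= a k.+1)%O -> ~ sval t x -> `|lam k x| <= k.+1%:R^-1]].
Proof.
have /choice[f fP] : forall ka : nat * A, exists p : (A -> R) * A * A,
    sval t ka.2 -> let: (lam, b, a') := p in
  [/\ is_measure lam,
      exists2 n, (ka.1 <= n)%N & forall x, `|lam x| <= `|mu n x|,
      forall x, (x <= ~` ka.2)%O -> `|lam x| <= ka.1.+1%:R^-1,
      (b <= ka.2)%O /\ (ka.1.+2%:R < `|lam b|) &
      [/\ sval t a', (a' <= ka.2)%O, (b `&` a' = \bot)%O &
        forall x, (x <= a')%O -> ~ sval t x -> `|lam x| <= ka.1.+1%:R^-1]].
  move=> [k a] /=; have [ta|nta] := pselect (sval t a).
    by have [p pP] := concentration_step k a ta; exists p.
  (* An arbitrary value where the premise fails, since [choice] needs a total function. *)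
  by exists (mu 0, a, a).
pose a := fix a k := if k is j.+1 then (f (j, a j)).2 else \top%O.
have ta k : sval t (a k).
  elim: k => [|k IH] /=; first by case: (svalP t) => -[].
  by have := fP (k, a k) IH; case: (f _) => -[lam b] a' /= [_ _ _ _ []].
exists a, (fun k => (f (k, a k)).1.2), (fun k => (f (k, a k)).1.1); split=> // k.
have /= := fP (k, a k) (ta k); case: (f (k, a k)) => -[lam b] a' /=.
by move=> [? ? ? ? []].
Qed.

End ConcentrationPoint.

(** * Cancelling the atoms and assembling the antichain *)

Lemma balancing_coefficients {R : realType} (x y : R) : exists r s : R,
  [/\ r * x = s * y, `|r| <= 1, `|s| <= 1 & `|r| = 1 \/ `|s| = 1].
Proof.
wlog xy : x y / `|x| <= `|y| => [hw|].
  have [/hw//|/ltW/hw[s [r [e ? ? o]]]] := leP `|x| `|y|.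
  by exists r, s; split=> //; case: o; [right|left].
have [y0|y0] := eqVneq y 0.
  have x0 : x = 0.
    apply/normr0_eq0/le_anti; rewrite normr_ge0 andbT.
    by rewrite (le_trans xy)// y0 normr0.
  by exists 1, 1; rewrite x0 y0 normr1; split=> //; left.
exists 1, (x / y); rewrite mul1r divfK// normr1; split=> //; last by left.
by rewrite normrM normfV ler_pdivrMr ?normr_gt0// mul1r.
Qed.

Theorem theorem3p18 (R : realType) (d : Order.disp_t)
    (A : ctbDistrLatticeType d) (infA : infinite_set [set: A])
    (hA : exists mu : nat -> A -> R,
        anti_nikodym mu /\ exists t : stone A, strong_nikodym_point mu t) :
  exists (nu : nat -> A -> R) (B : nat -> A),
    [/\ anti_nikodym nu, antichain B &
        forall k : nat,
          radon_support (radon_extension (nu k)) `<=` stone_set (B k) /\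
          (k%:R%:E < variation_norm (nu k))%E].
Proof.
have [mu [[mmu mu0 _] [t tmu]]] := hA.
have [a [b [lam [ta alamP]]]] := concentration_sequence mu t mmu tmu.
have mlam k : is_measure (lam k) by case: (alamP k).
have aS k : (a k.+1 <= a k)%O by case: (alamP k) => _ _ _ _ [].
have amono i j : (i <= j)%N -> (a j <= a i)%O.
  elim: j => [|j IH]; first by rewrite leqn0 => /eqP ->.
  by rewrite leq_eqVlt => /predU1P[->//|/IH]; apply: le_trans.
have /choice[r /choice[s rsP]] : forall k, exists r s : R,
    [/\ r * lam k.*2 (a k.*2.+2) = s * lam k.*2.+1 (a k.*2.+2),
        `|r| <= 1, `|s| <= 1 & `|r| = 1 \/ `|s| = 1].
  by move=> k; apply: balancing_coefficients.
pose kap k x := r k * lam k.*2 x + - s k * lam k.*2.+1 x.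
have mkap k : is_measure (kap k) by apply: is_measure_comb.
have kap_le k x : `|kap k x| <= `|lam k.*2 x| + `|lam k.*2.+1 x|.
  have [_ r1 s1 _] := rsP k; apply: (le_trans (ler_normD _ _)).
  by rewrite !normrM normrN lerD// ler_piMl.
pose B k := (a k.*2 `&` ~` a k.*2.+2)%O.
pose nu k := Defs.mrestrict (kap k) (B k).
have Bb k : (b k.*2 <= B k)%O /\ (b k.*2.+1 <= B k)%O.
  have [_ _ _ [ba _] [_ ba0 _]] := alamP k.*2.
  have [_ _ _ [ba' _] [_ ba0' _]] := alamP k.*2.+1.
  rewrite !lexI ba (le_trans ba' (aS _)) -!disj_leC ba0' eqxx; split=> //=.
  by rewrite -lex0 -ba0 leI2.
have norm_nu k : (k%:R%:E < variation_norm (nu k))%E.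
  have nu_ge x : (x <= B k)%O -> k%:R < `|kap k x| ->
      (k%:R%:E < variation_norm (nu k))%E.
    move=> /meet_idPr xB kx; apply: lt_le_trans (variation_norm_ge _ x).
    by rewrite lte_fin /nu /Defs.mrestrict xB.
  have [_ _ _ [ba bbig] [_ ba0 asm]] := alamP k.*2.
  have [_ _ asm' [ba' bbig'] [_ ba0' _]] := alamP k.*2.+1.
  have [Bb1 Bb2] := Bb k; have [_ r1 s1 rs] := rsP k.
  have le1 (n : nat) : n.+1%:R^-1 <= 1 :> R by rewrite invf_le1 ?ler1n.
  have kk : k%:R <= k.*2%:R :> R by rewrite ler_nat -addnn leq_addr.
  have kS2 : k.*2.+2%:R = k.*2%:R + 2 :> R by rewrite -addn2 natrD.
  have kS3 : k.*2.+3%:R = k.*2%:R + 3 :> R by rewrite -addn3 natrD.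
  (* The term with coefficient of modulus 1 exceeds [k.*2.+2], and the other one is at most 1. In
     the first case [b k.*2] is disjoint from [a k.*2.+1]; in the second [b k.*2.+1] lies below
     [a k.*2.+1] and outside [t]. *)
  case: rs => [r_1|s_1]; [apply: (nu_ge _ Bb1)|apply: (nu_ge _ Bb2)].
    have : `|lam k.*2.+1 (b k.*2)| <= 1.
      by apply: le_trans (le1 k.*2.+1); apply: asm'; rewrite -disj_leC ba0.
    move=> h; have : `|- s k * lam k.*2.+1 (b k.*2)| <= 1.
      by rewrite normrM normrN mulr_ile1.
    have := lerB_normD (r k * lam k.*2 (b k.*2)) (- s k * lam k.*2.+1 (b k.*2)).
    by rewrite (normrM (r k)) r_1 mul1r -/(kap k _); lra.
  have : `|lam k.*2 (b k.*2.+1)| <= 1.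
    apply: le_trans (le1 k.*2); apply: asm => //.
    by rewrite meetC in ba0'; apply: stone_disj ba0' (ta _).
  move=> h; have : `|r k * lam k.*2 (b k.*2.+1)| <= 1.
    by rewrite normrM mulr_ile1.
  have := lerB_normD (- s k * lam k.*2.+1 (b k.*2.+1))
    (r k * lam k.*2 (b k.*2.+1)).
  rewrite [X in _ <= `|X|]addrC (normrM (- s k)) normrN s_1 mul1r.
  by rewrite -/(kap k _); lra.
exists nu, B; split; last first.
- move=> k; split=> //; apply: radon_support_extension_sub => x xB.
  have [U _] := mkap k.
  have -> : nu k x = kap k \bot%O.
    by rewrite /nu /Defs.mrestrict meetC; congr kap; apply/eqP; rewrite disj_leC.
  by apply: (@addrI _ (kap k \bot%O)); rewrite -U ?meetxx// joinxx addr0.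
- move=> i j; wlog ij : i j / (i < j)%N => [hw|_].
    move=> /eqP nij; have := nij; rewrite neq_ltn => /orP[|] lt_ij.
      by apply: hw => //; apply/eqP.
    by rewrite meetC; apply: hw => //; apply/eqP; rewrite eq_sym.
  apply/eqP; rewrite meetC disj_leC complI complK.
  (* For [i < j], [B j] lies below [a i.*2.+2], which [B i] avoids. *)
  have BB : (B j <= a i.*2.+2)%O.
    by apply: le_trans (leIl _ _) _; apply: amono; rewrite -doubleS leq_double.
  by apply: le_trans BB _; rewrite leUr.
- split.
  + by move=> k; apply: is_measure_restrict.
  + move=> x; apply/cvgr0Pnorm_le => e e0.
    (* [nu k x] is [kap k x] minus the values of [kap k] on the parts of [x] outside [a k.*2] and
       inside [a k.*2.+2]. Each of these is at most twice [k.*2.+1%:R^-1]. *)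
    have bound k : `|nu k x| <=
        `|lam k.*2 x| + `|lam k.*2.+1 x| + 4 * k.*2.+1%:R^-1.
      have [_ _ osm _ [_ _ asm]] := alamP k.*2.
      have [_ _ osm' _ [_ _ asm']] := alamP k.*2.+1.
      set e' := k.*2.+1%:R^-1 in osm asm *.
      have le_e' : k.*2.+2%:R^-1 <= e' by rewrite lef_pV2 ?posrE// ler_nat.
      have outer y : (y <= ~` a k.*2)%O -> `|kap k y| <= 2 * e'.
        move=> ya; have := kap_le k y; have := osm y ya.
        have : (y <= ~` a k.*2.+1)%O by apply: le_trans ya _; rewrite leC.
        by move=> /osm' /le_trans /(_ le_e'); lra.
      have inner y : (y <= a k.*2.+2)%O -> ~ sval t y -> `|kap k y| <= 2 * e'.
        move=> ya nty; have := kap_le k y; have := le_trans (asm' y ya nty) le_e'.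
        by have := asm y (le_trans ya (aS _)) nty; lra.
      (* If [x] is in [t], then since [kap k] vanishes at [a k.*2.+2], its value on the part of [x]
         there is minus its value on the rest of [a k.*2.+2], which is outside [t]. *)
      have inner' : `|kap k (x `&` a k.*2.+2)%O| <= 2 * e'.
        have [tx|ntx] := pselect (sval t x); last first.
          by apply: inner; [exact: leIr|move=> /stoneI[]].
        have [rs0 _ _ _] := rsP k.
        have := measure_split _ x (a k.*2.+2) (mkap k).
        have -> : kap k (a k.*2.+2) = 0 by rewrite /kap mulNr rs0 subrr.
        rewrite meetC => /esym/eqP; rewrite addr_eq0 => /eqP ->; rewrite normrN.
        by apply: inner; [exact: leIl|move=> /stoneI[_ /stoneC]].
      have := outer (x `&` ~` a k.*2)%O (leIr _ _).
      have := measure_split _ (a k.*2) x (mkap k).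
      rewrite (measure_split _ (a k.*2.+2) (x `&` a k.*2)%O (mkap k)).
      rewrite -!meetA (meet_idPr (le_trans (aS k.*2.+1) (aS k.*2))).
      rewrite (meetC x (a k.*2 `&` ~` _)%O).
      rewrite -[kap k (_ `&` ~` _ `&` x)%O]/(nu k x).
      move=> kE ho; have := kap_le k x; move: inner' ho; rewrite kE.
      rewrite !ler_norml => /andP[? ?] /andP[? ?] /andP[? ?].
      by apply/andP; split; lra.
    (* The three terms of [bound] will be at most [e / 8], [e / 8] and [4 * (e / 8)]. *)
    have e8 : 0 < e / 8 by rewrite divr_gt0.
    have /cvgr0Pnorm_le/(_ _ e8)[N1 _ N1P] := mu0 x.
    have [N2 _ N2P] := near_infty_natSinv_lt (PosNum e8).
    exists (N1 + N2)%N => // k /= Nk.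
    (* Pointwise convergence is inherited because [lam i] is dominated by some [mu n] with
       [i <= n]. *)
    have lam_le i : (N1 <= i)%N -> `|lam i x| <= e / 8.
      move=> N1i; have [_ [n /(leq_trans N1i) N1n lamn] _ _ _] := alamP i.
      exact: le_trans (lamn x) (N1P n N1n).
    have kk : (k <= k.*2)%N by rewrite -addnn leq_addr.
    have N1k : (N1 <= k.*2)%N.
      by apply: leq_trans kk; apply: leq_trans Nk; rewrite leq_addr.
    have N2k : (N2 <= k.*2)%N.
      by apply: leq_trans kk; apply: leq_trans Nk; rewrite leq_addl.
    have := bound k; have := lam_le _ N1k; have := lam_le _ (leqW N1k).
    have : k.*2.+1%:R^-1 < e / 8 := N2P _ N2k.
    by set e' := k.*2.+1%:R^-1; lra.
  + apply/eqyP => M M0.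
    apply: (@le_trans _ _ (variation_norm (nu (Num.truncn M).+1))).
      apply/ltW/(lt_trans _ (norm_nu _)); rewrite lte_fin; exact: truncnS_gt.
    by apply: ereal_sup_ubound; exists (Num.truncn M).+1.
Qed.
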